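(* Let $A$ and $B$ be monounary algebras. The direct product $A\times B$ is residually finite if and only if one of the following holds: (1) both $A$ and $B$ are residually finite; (2) $A$ is backwards-bounded; (3) $B$ is backwards-bounded.
   Context: $\mathbb{N}$ is the set of non-negative integers. A monounary algebra $(A,f)$ is a (possibly empty) set $A$ with a function $f:A\to A$. A homomorphism $\phi:(A,f_1)\to(B,f_2)$ is a function with $\phi(f_1(a))=f_2(\phi(a))$ for all $a\in A$. The direct product of $(A,f_1)$ and $(B,f_2)$ is $A\times B$ with operation $f(a,b)=(f_1(a),f_2(b))$. $A$ is residually finite if for all distinct $x,y\in A$ there exist a finite monounary algebra $F$ and a homomorphism $\phi:A\to F$ with $\phi(x)\neq\phi(y)$. For $a\in A$ and $n\in\mathbb{N}$, $f^{-n}(a)=\{b\in A: f^n(b)=a\}$ (with $f^0$ the identity). $(A,f)$ is backwards-bounded if for all $a\in A$ there exists $n\in\mathbb{N}$ such that $f^{-n}(a)=\varnothing$. ''One of the following'' means at least one. *)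

(* Defs.v *)
From mathcomp Require Import all_boot.
From mathcomp Require Import boolp classical_sets.

Set Implicit Arguments.
Unset Strict Implicit.
Unset Printing Implicit Defensive.

Local Open Scope classical_set_scope.

Record monounary : Type := Monounary {
  carrier :> Type;
  op : carrier -> carrier
}.

Arguments op : clear implicits.

Definition homomorphism (A B : monounary) (phi : A -> B) : Prop :=
  forall a : A, phi (op A a) = op B (phi a).

Definition direct_product (A B : monounary) : monounary :=
  @Monounary (A * B)%type (fun p => (op A p.1, op B p.2)).

Definition residually_finite (A : monounary) : Prop :=
  forall x y : A, x <> y ->
    exists (F : finType) (g : F -> F) (phi : A -> Monounary g),
      homomorphism phi /\ phi x <> phi y.

Definition backward_iter (A : monounary) (n : nat) (a : A) : set A :=
  iter n (op A) @^-1` [set a].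

Definition backwards_bounded (A : monounary) : Prop :=
  forall a : A, exists n : nat, backward_iter n a = set0.

(* Main.v *)
Require Import Defs.
From mathcomp Require Import all_boot.
From mathcomp Require Import boolp classical_sets.

(** Write f for every operation, and say that an element is deep when it has
    iterated preimages of every order.  Backwards-boundedness says that no
    element is deep, and an element of a product is deep exactly when both of
    its coordinates are.

    Which pairs x <> y can a finite quotient separate?
    - If x or y is not deep, they are always separated
      ([separated_of_shallow]).
    - If f^n x and f^n y differ for all n, they are always separated
      ([separated_of_never_merging]).
    - If x and y are deep and f^n x = f^n y for some n, they never are: a deep
      element is sent to a point lying on a cycle of the finite algebra, and f
      is injective on such points ([deep_merging_eq]).

    Both positive results come from one construction, [separated_of_periodic]:
    a set U whose preimages f^{-k}(U) are eventually periodic in k is the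
    preimage of a set under a homomorphism to a finite algebra, which records
    for an element z the finitely many truth values f^k z \in U.

    So A is residually finite exactly when distinct deep elements never merge.
    If A is backwards-bounded, then A x B has no deep elements at all, and is
    residually finite.  Conversely, if B has a deep element b, two deep elements
    x <> y of A which merge yield the deep elements (x, b) <> (y, b) of A x B,
    which merge as well; hence residual finiteness passes from A x B to A. *)

Set Implicit Arguments.
Unset Strict Implicit.
Unset Printing Implicit Defensive.

Local Open Scope classical_set_scope.

Definition separated (A : monounary) (x y : A) : Prop :=
  exists (F : finType) (g : F -> F) (phi : A -> Monounary g),
    homomorphism phi /\ phi x <> phi y.

Definition deep (A : monounary) (x : A) : Prop :=
  forall n, exists u, iter n (op A) u = x.

Lemma separated_sym (A : monounary) (x y : A) :
  separated x y -> separated y x.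
Proof.
move=> [F [g [phi [hom neq]]]]; exists F, g, phi; split=> // e.
exact: neq.
Qed.

Lemma iter_homomorphism (A B : monounary) (phi : A -> B) n x :
  homomorphism phi -> phi (iter n (op A) x) = iter n (op B) (phi x).
Proof. by move=> hom; elim: n => //= n IHn; rewrite hom IHn. Qed.

Lemma iter_direct_product (A B : monounary) n (p : direct_product A B) :
  iter n (op (direct_product A B)) p =
  (iter n (op A) p.1, iter n (op B) p.2).
Proof. by elim: n => [|n IHn] /=; [case: p|rewrite IHn]. Qed.

Lemma not_deepP (A : monounary) (x : A) :
  ~ deep x <-> exists n, backward_iter n x = set0.
Proof.
split=> [/existsNP[n nex]|[n e0] dx].
  by exists n; apply/seteqP; split=> // u /= e; apply: nex; exists u.
have [u eu] := dx n.
have : backward_iter n x u by [].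
by rewrite e0.
Qed.

Lemma backwards_boundedP (A : monounary) :
  backwards_bounded A <-> forall x : A, ~ deep x.
Proof. by split=> bb x; apply/not_deepP; exact: bb. Qed.

Lemma deep_pair (A B : monounary) (a : A) (b : B) :
  @deep (direct_product A B) (a, b) <-> deep a /\ deep b.
Proof.
split=> [dab|[da db] n].
  by split=> n; have [[u v]] := dab n; rewrite iter_direct_product => -[eu ev];
    [exists u|exists v].
have [[u eu] [v ev]] := (da n, db n).
by exists (u, v); rewrite iter_direct_product /= eu ev.
Qed.

(** * Separating elements *)

(** The sets f^{-k}(U) with k < n exhaust all the f^{-k}(U), so the subset
    {k < n | f^k z \in U} of 'I_n determines the one attached to f z: it is
    obtained by a shift of indices, in which n wraps around to m. *)
Lemma separated_of_periodic (A : monounary) (U : set A) (m n : nat) (x y : A) :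
  m < n -> (forall z, U (iter n (op A) z) <-> U (iter m (op A) z)) ->
  U x -> ~ U y -> separated x y.
Proof.
move=> mn per Ux Uy.
pose shift (k : 'I_n) : 'I_n := insubd (Ordinal mn) k.+1.
pose g (S : {set 'I_n}) : {set 'I_n} := [set k | shift k \in S]%SET.
pose phi (z : A) : Monounary g :=
  [set k : 'I_n | `[< U (iter k (op A) z) >]]%SET.
exists {set 'I_n}, g, phi; split=> [z|/finset.setP eqphi].
  apply/finset.setP => k; rewrite !finset.inE -iterSr val_insubd.
  apply: asbool_equiv_eq; case: ltnP => // nk.
  by have -> : k.+1 = n by apply/eqP; rewrite eqn_leq nk ltn_ord.
have n_gt0 : 0 < n := leq_ltn_trans (leq0n m) mn.
have := eqphi (Ordinal n_gt0); rewrite !finset.inE /= => e.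
by apply: Uy; apply/asboolP; rewrite -e; apply/asboolP.
Qed.

(** When f^{-n}(x) is empty, so are all later preimages of the set {x}. *)
Lemma separated_of_shallow (A : monounary) (x y : A) :
  x <> y -> ~ deep x -> separated x y.
Proof.
move=> neq /existsNP[n nex].
apply: (@separated_of_periodic A [set x] n n.+1) => //= [z|/esym //].
split=> e; case: nex; last by exists z.
by exists (op A z); rewrite -iterSr.
Qed.

(** The set of the z with f^p z = f^q x for some p = q modulo d is its own
    preimage under f^d. *)
Lemma separated_of_modulus (A : monounary) (x y : A) (d : nat) :
  0 < d ->
  (forall p q, iter p (op A) y = iter q (op A) x -> p <> q %[mod d]) ->
  separated x y.
Proof.
move=> d_gt0 ndiff.
pose U : set A := [set z | exists p q,
  iter p (op A) z = iter q (op A) x /\ p = q %[mod d]].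
apply: (@separated_of_periodic A U 0 d) => //.
- move=> z; split=> /= -[p [q [e pq]]].
    by exists (p + d), q; rewrite iterD modnDr.
  by exists p, (d + q); rewrite -iterD addnC !iterD e modnDl.
- by exists 0, 0.
- by move=> [p [q [e pq]]]; exact: ndiff e pq.
Qed.

Lemma iter_period_mul (T : Type) (f : T -> T) (x : T) (N d k : nat) :
  iter (N + d) f x = iter N f x -> iter (N + k * d) f x = iter N f x.
Proof.
move=> e; elim: k => [|k IHk]; first by rewrite addn0.
by rewrite mulSn addnCA iterD IHk -iterD addnC.
Qed.

Lemma iter_eq_mod (T : Type) (f : T -> T) (x : T) (N d p q : nat) :
  iter (N + d) f x = iter N f x -> p = q %[mod d] ->
  iter (N + p) f x = iter (N + q) f x.
Proof.
move=> e pq.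
have red r : iter (N + r) f x = iter (r %% d + N) f x.
  by rewrite {1}(divn_eq r d) addnCA addnA addnC [_ + N]addnC iterD
             iter_period_mul // -iterD.
by rewrite !red pq.
Qed.

(** A coincidence f^p y = f^q x with p = q modulo d has to be excluded.  If x
    is preperiodic, its period works as d, since such a coincidence would make
    x and y merge.  Otherwise q - p takes at most one value, which is
    nonzero, and any larger modulus works. *)
Lemma separated_of_never_merging (A : monounary) (x y : A) :
  (forall n, iter n (op A) x <> iter n (op A) y) -> separated x y.
Proof.
move=> nmerge.
have [[N [d [d_gt0 e]]]|nper] :=
    pselect (exists N d, 0 < d /\ iter (N + d) (op A) x = iter N (op A) x).
  apply: (separated_of_modulus d_gt0) => p q epq pq.
  apply: (nmerge (N + p)).
  by rewrite (iter_eq_mod e pq) !iterD epq.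
have inj p q : iter p (op A) x = iter q (op A) x -> p = q.
  wlog le_pq : p q / p <= q.
    by move=> wl; case/orP: (leq_total p q) => le e;
      [|symmetry]; apply: wl.
  move=> e; apply/eqP; rewrite eqn_leq le_pq leqNgt; apply/negP => lt_pq.
  by apply: nper; exists p, (q - p); rewrite subn_gt0 subnKC.
have [[p0 [q0 e0]]|ndiff] :=
    pselect (exists p q, iter p (op A) y = iter q (op A) x); last first.
  by apply: (@separated_of_modulus _ _ _ 1) => // p q e; case: ndiff; exists p, q.
apply: (@separated_of_modulus _ _ _ (p0 + q0).+1) => // p q e pq.
have eD : q0 + p = q + p0.
  by apply: inj; rewrite addnC (addnC q) !iterD -e0 -e -!iterD addnC.
have : p0 = q0 %[mod (p0 + q0).+1].
  by apply/eqP; rewrite -(eqn_modDl q) -eD addnC eqn_modDr; apply/eqP.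
rewrite !modn_small ?ltnS ?leq_addr ?leq_addl // => pq0.
by apply: (nmerge p0); rewrite e0 pq0.
Qed.

(** * Elements that cannot be separated *)

(** The iterates of g range over the finite type of self-maps of F, so two of
    them coincide. *)
Lemma iter_finite_periodic (F : finType) (g : F -> F) :
  exists N d, 0 < d /\ forall z, iter (N + d) g z = iter N g z.
Proof.
pose h (k : 'I_#|{ffun F -> F}|.+1) := [ffun z => iter k g z].
have /injectivePn[i [j neq /ffunP e]] : ~~ injectiveb h.
  by apply/negP => /injectiveP /leq_card; rewrite card_ord ltnn.
wlog lt_ij : i j neq e / i < j.
  move=> wl; case: (ltngtP i j) => [lt|lt|/ord_inj eij].
  - exact: (wl i j).
  - by apply: (wl j i); rewrite 1?eq_sym.
  - by rewrite eij eqxx in neq.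
exists i, (j - i); rewrite subn_gt0 (subnKC (ltnW lt_ij)); split=> // z.
by have := e z; rewrite !ffunE.
Qed.

(** If g^(N + d) = g^N in the finite algebra, deep elements have images fixed
    by g^d, hence by g^(n * d).  Since n <= n * d, that iterate of g also takes
    equal values at the images of x and y. *)
Lemma deep_merging_eq (A : monounary) (x y : A) (n : nat) :
  residually_finite A -> deep x -> deep y ->
  iter n (op A) x = iter n (op A) y -> x = y.
Proof.
move=> rfA dx dy merge; apply: contrapT => /rfA[F [g [phi [hom neq]]]].
have [N [d [d_gt0 per]]] := iter_finite_periodic g.
have fixed z : deep z -> iter (n * d) g (phi z) = phi z.
  move=> /(_ N)[u <-].
  by rewrite iter_homomorphism // -iterD addnC iter_period_mul.
apply: neq; rewrite -fixed // -[RHS]fixed //.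
by rewrite -(subnK (leq_pmulr n d_gt0)) !iterD
  -!(iter_homomorphism n _ hom) merge.
Qed.

(** * Residual finiteness *)

Lemma residually_finite_of_deep (A : monounary) :
  (forall (x y : A) n, deep x -> deep y ->
     iter n (op A) x = iter n (op A) y -> x = y) ->
  residually_finite A.
Proof.
move=> nmerge x y neq; rewrite -/(separated x y).
have [dx|] := pselect (deep x); last exact: separated_of_shallow.
have [dy|ndy] := pselect (deep y); last first.
  by apply/separated_sym/separated_of_shallow => // e; apply: neq.
by apply: separated_of_never_merging => n /nmerge e; apply: neq; exact: e.
Qed.

Lemma residually_finite_backwards_bounded (A : monounary) :
  backwards_bounded A -> residually_finite A.
Proof.
by move=> /backwards_boundedP bb; apply: residually_finite_of_deep => x y n /bb.
Qed.

Lemma separated_pullback (A B : monounary) (psi : A -> B) (x y : A) :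
  homomorphism psi -> separated (psi x) (psi y) -> separated x y.
Proof.
move=> hpsi [F [g [phi [hphi neq]]]].
by exists F, g, (phi \o psi); split=> // z /=; rewrite hpsi hphi.
Qed.

Lemma residually_finite_direct_product (A B : monounary) :
  residually_finite A -> residually_finite B ->
  residually_finite (direct_product A B).
Proof.
move=> rfA rfB [a b] [a' b'] neq; rewrite -/(separated _ _).
have [ea|na] := pselect (a = a'); last first.
  by apply: (@separated_pullback (direct_product A B) A fst) => //; exact: rfA.
apply: (@separated_pullback (direct_product A B) B snd) => //; apply: rfB => /= eb.
by apply: neq; rewrite ea eb.
Qed.

Lemma residually_finite_swap (A B : monounary) :
  residually_finite (direct_product A B) ->
  residually_finite (direct_product B A).
Proof.
move=> rf [b a] [b' a'] neq.
apply: (@separated_pullback (direct_product B A) (direct_product A B)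
         (fun p => (p.2, p.1))) => //.
by apply: rf => -[ea eb]; apply: neq; rewrite ea eb.
Qed.

(** A deep element b of B turns merging deep elements x, y of A into merging
    deep elements (x, b), (y, b) of the product. *)
Lemma residually_finite_factor (A B : monounary) :
  residually_finite (direct_product A B) -> ~ backwards_bounded B ->
  residually_finite A.
Proof.
move=> rf /backwards_boundedP/existsNP[b /contrapT db].
apply: residually_finite_of_deep => x y n dx dy merge.
have : (x, b) = (y, b) :> direct_product A B.
  by apply: (@deep_merging_eq _ _ _ n rf); rewrite ?deep_pair
    ?iter_direct_product //= merge.
by case.
Qed.

Theorem theorem5p6 (A B : monounary) :
  residually_finite (direct_product A B) <->
  (residually_finite A /\ residually_finite B) \/
  backwards_bounded A \/
  backwards_bounded B.
Proof.
split=> [rf|[[rfA rfB]|bb]].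
- have [bbA|nbA] := pselect (backwards_bounded A); first by right; left.
  have [bbB|nbB] := pselect (backwards_bounded B); first by right; right.
  left; split; first exact: residually_finite_factor rf nbB.
  exact: residually_finite_factor (residually_finite_swap rf) nbA.
- exact: residually_finite_direct_product.
- apply/residually_finite_backwards_bounded/backwards_boundedP => -[a b].
  by case: bb => /backwards_boundedP bb /deep_pair[da db];
    [exact: bb da|exact: bb db].
Qed.
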